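(* Let $K$ be a field, $Q$ a quiver, $a$ a sink of $Q$, $\boldsymbol{\underline d}=(\underline d^0,\dots,\underline d^\nu)$ a filtration and $M$ a $K$-representation of $Q$ of dimension vector $\underline d^\nu$ (with $\dim\mathrm{Hom}(M,S_a)=s$ arbitrary). Then $\mathrm{Fl}_Q\binom{M}{\boldsymbol{\underline d}}$ is empty if and only if $\mathrm{Fl}_{\sigma_aQ}\binom{S_a^+M}{S_a^+\boldsymbol{\underline d}}$ is empty. Moreover, if $K=\mathbb{F}_q$ is a finite field, then $$\#\mathrm{Fl}_Q\binom{M}{\boldsymbol{\underline d}}\equiv\#\mathrm{Fl}_{\sigma_aQ}\binom{S_a^+M}{S_a^+\boldsymbol{\underline d}}\pmod q.$$
   Context: $Q$ is a finite quiver, $S_a$ the simple at $a$. A filtration is a sequence of dimension vectors with $\underline d^0=0$, $\underline d^i\le\underline d^{i+1}$; it is a filtration of a representation $M$ if moreover $\underline d^\nu=\underline\dim M$. $\mathrm{Fl}_Q\binom{M}{\boldsymbol{\underline d}}$ is the set (variety) of flags $U^0\subset\dots\subset U^\nu=M$ of subrepresentations with $\underline\dim U^i=\underline d^i$; it is empty if $\boldsymbol{\underline d}$ is not a filtration of $M$. $\sigma_aQ$ is obtained from $Q$ by reversing all arrows at $a$. $\sigma_a\underline d=\underline d-(\underline d,\epsilon_a)\epsilon_a$, where $(\underline d,\underline e)=\langle\underline d,\underline e\rangle+\langle\underline e,\underline d\rangle$, $\langle\underline d,\underline e\rangle=\sum_id_ie_i-\sum_{\alpha:i\to j}d_ie_j$,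 and $\epsilon_a$ is the unit vector at $a$. $S_a^+M$ is the representation of $\sigma_aQ$ with $(S_a^+M)_i=M_i$ for $i\ne a$, $(S_a^+M)_a=\ker\left((M_\alpha)\colon\bigoplus_{\alpha:j\to a}M_j\to M_a\right)$ and the natural maps (inclusion followed by projection) on the reversed arrows. Define integers $r_+^0=0$ and $r_+^i=\max\{0,(\sigma_a(\underline d^{i-1}-\underline d^i))_a+r_+^{i-1}\}$ for $0<i<\nu$. Then $S_a^+\boldsymbol{\underline d}$ is the sequence $$(0,\ \sigma_a\underline d^1+r_+^1\epsilon_a,\ \dots,\ \sigma_a\underline d^{\nu-1}+r_+^{\nu-1}\epsilon_a,\ \underline\dim S_a^+M).$$ *)

(* Defs.v *)
From HB Require Import structures.
From mathcomp Require Import all_boot all_order all_algebra.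

Set Implicit Arguments.
Unset Strict Implicit.
Unset Printing Implicit Defensive.

Import Order.TTheory GRing.Theory Num.Theory.
Local Open Scope ring_scope.

Section DirectSum.
Import VectorInternalTheory.
Variables (K : fieldType) (I : finType) (V : I -> vectType K).

(* vector.v only equips the non-dependent {ffun I -> V} with a vectType. *)
Definition dsum := {dffun forall i : I, V i}.

HB.instance Definition _ := Choice.on dsum.

Implicit Types (f g : dsum).

Definition dsum_zero : dsum := [ffun i => 0 : V i].
Definition dsum_add f g : dsum := [ffun i => f i + g i].
Definition dsum_opp f : dsum := [ffun i => - f i].
Definition dsum_scale (c : K) f : dsum := [ffun i => c *: f i].

Fact dsum_addA : associative dsum_add.
Proof. by move=> f g h; apply/ffunP=> i; rewrite !ffunE addrA. Qed.
Fact dsum_addC : commutative dsum_add.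
Proof. by move=> f g; apply/ffunP=> i; rewrite !ffunE addrC. Qed.
Fact dsum_add0 : left_id dsum_zero dsum_add.
Proof. by move=> f; apply/ffunP=> i; rewrite !ffunE add0r. Qed.
Fact dsum_addN : left_inverse dsum_zero dsum_opp dsum_add.
Proof. by move=> f; apply/ffunP=> i; rewrite !ffunE addNr. Qed.

HB.instance Definition _ :=
  GRing.isZmodule.Build dsum dsum_addA dsum_addC dsum_add0 dsum_addN.

Fact dsum_scaleA b c f : dsum_scale b (dsum_scale c f) = dsum_scale (b * c) f.
Proof. by apply/ffunP=> i; rewrite !ffunE scalerA. Qed.
Fact dsum_scale1 : left_id 1 dsum_scale.
Proof. by move=> f; apply/ffunP=> i; rewrite !ffunE scale1r. Qed.
Fact dsum_scaleDr : right_distributive dsum_scale +%R.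
Proof. by move=> c f g; apply/ffunP=> i; rewrite !ffunE scalerDr. Qed.
Fact dsum_scaleDl f : {morph dsum_scale^~ f : b c / b + c}.
Proof. by move=> b c; apply/ffunP=> i; rewrite !ffunE scalerDl. Qed.

HB.instance Definition _ := GRing.Zmodule_isLmodule.Build K dsum
  dsum_scaleA dsum_scale1 dsum_scaleDr dsum_scaleDl.

Lemma dsumP (c : K) (f g : dsum) i : (c *: f + g) i = c *: f i + g i.
Proof. by rewrite !ffunE. Qed.

Fact dsum_vect_iso :
  Vector.axiom #|{: {i : I & 'I_(dim (V i))}}| dsum.
Proof.
pose T : finType := {i : I & 'I_(dim (V i))}.
pose v2row (f : dsum) : 'rV[K]_#|{: T}| :=
  \row_k (let s : T := enum_val k in v2r (f (tag s)) 0 (tagged s)).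
pose row2v (r : 'rV[K]_#|{: T}|) : dsum :=
  [ffun i => r2v (\row_j r 0 (enum_rank (Tagged _ j : T)))].
exists v2row; first by move=> c f g; apply/rowP=> k; rewrite !mxE /= dsumP linearP !mxE.
exists row2v => [f|r].
  apply/ffunP=> i; rewrite ffunE; apply/(canLR v2rK)/rowP=> j.
  by rewrite !mxE enum_rankK.
apply/rowP=> k; rewrite mxE /= ffunE r2vK mxE; congr (r 0 _).
by apply: (canLR enum_valK); case: (enum_val k).
Qed.

HB.instance Definition _ := Lmodule_hasFinDim.Build K dsum dsum_vect_iso.

End DirectSum.

Section FiniteVspace.
Import VectorInternalTheory.
Variables (K : finFieldType) (V : vectType K).

HB.instance Definition _ := [Countable of {vspace V} by <:].
HB.instance Definition _ := [Finite of {vspace V} by <:].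

End FiniteVspace.

Record quiver := Quiver {
  vertex :> finType;
  arrow : vertex -> vertex -> finType
}.

Definition is_sink (Q : quiver) (a : Q) := forall j : Q, #|arrow a j| = 0%N.

Definition reflected_arrow (Q : quiver) (a i j : Q) : finType :=
  if (i == a) || (j == a) then arrow j i else arrow i j.

Definition reflected_quiver (Q : quiver) (a : Q) : quiver := Quiver (reflected_arrow a).

(* Dimension vectors are integer-valued, because sigma_a d may leave N^Q; on the
   terms of a filtration nonnegativity is automatic (see is_filtration). *)
Notation dimvec Q := {ffun vertex Q -> int}.

Section DimensionVectors.
Variable Q : quiver.
Implicit Types (d e : dimvec Q) (a i j : Q).

Definition unit_vec a : dimvec Q := [ffun i => (i == a)%:R].

Definition euler_form d e : int :=
  \sum_i d i * e i - \sum_i \sum_j \sum_(alpha : arrow i j) d i * e j.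

Definition sym_euler_form d e : int := euler_form d e + euler_form e d.

Definition sigma a d : dimvec Q := d - unit_vec a *~ sym_euler_form d (unit_vec a).

Definition is_filtration nu (d : 'I_nu.+1 -> dimvec Q) : bool :=
  (d ord0 == 0) &&
  [forall k : 'I_nu, forall i : Q,
     d (widen_ord (leqnSn nu) k) i <= d (lift ord0 k) i].

(* Only the values for i < nu are used. *)
Fixpoint r_plus a nu (d : 'I_nu.+1 -> dimvec Q) (i : nat) : int :=
  if i is k.+1 then
    Num.max 0 (sigma a (d (inord k) - d (inord k.+1)) a + r_plus a d k)
  else 0.

End DimensionVectors.

Record representation (K : fieldType) (Q : quiver) := Representation {
  space_at :> Q -> vectType K;
  map_of : forall i j : Q, arrow i j -> 'Hom(space_at i, space_at j)
}.

Notation subspaces M := {dffun forall i : vertex _, {vspace (space_at M i)}}.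
Notation flag_type nu M := {ffun 'I_nu.+1 -> subspaces M}.

Section Representations.
Variables (K : fieldType) (Q : quiver).

Definition dim_vec (M : representation K Q) : dimvec Q :=
  [ffun i => (\dim {: M i})%:Z].

Definition is_filtration_of nu (M : representation K Q)
    (d : 'I_nu.+1 -> dimvec Q) : bool :=
  is_filtration d && (d ord_max == dim_vec M).

Definition is_subrep (M : representation K Q) (U : subspaces M) : bool :=
  [forall i : Q, forall j : Q, forall alpha : arrow i j,
     (map_of M alpha @: U i <= U j)%VS].

End Representations.

(* The condition is_filtration_of M d makes Fl M d empty when d is not a
   filtration of M, even if, e.g., only d ord0 = 0 fails. *)
Definition Fl (K : fieldType) (Q : quiver) (nu : nat) (M : representation K Q)
    (d : 'I_nu.+1 -> dimvec Q) : pred (flag_type nu M) :=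
  [pred U : flag_type nu M |
    [&& is_filtration_of M d,
        [forall k, is_subrep (U k)],
        [forall k, forall i, (\dim (U k i))%:Z == d k i],
        [forall k : 'I_nu, forall i : Q,
          (U (widen_ord (leqnSn nu) k) i <= U (lift ord0 k) i)%VS] &
        [forall i, U ord_max i == fullv]]].
Arguments Fl {K Q nu} M d.

Section Reflection.
Variables (K : fieldType) (Q : quiver).
Implicit Types (M : representation K Q) (a i j : Q).

Definition arrows_to i : finType := {j : Q & arrow j i}.

Definition incoming_sum M i : vectType K :=
  dsum (fun s : arrows_to i => M (tag s)).

Definition incoming_map M i (x : incoming_sum M i) : M i :=
  \sum_(s : arrows_to i) map_of M (tagged s) (x s).

Fact incoming_map_is_linear M i : linear (@incoming_map M i).
Proof.
move=> c x y; rewrite /incoming_map scaler_sumr -big_split /=.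
by apply: eq_bigr => s _; rewrite dsumP linearP.
Qed.

HB.instance Definition _ M i :=
  GRing.isLinear.Build K (incoming_sum M i) (M i) _ (@incoming_map M i)
    (@incoming_map_is_linear M i).

Definition incoming_ker M i : {vspace incoming_sum M i} :=
  lker (linfun (@incoming_map M i)).

Definition incoming_proj M i j (alpha : arrow j i) (x : incoming_sum M i) : M j :=
  x (Tagged (fun j => arrow j i) alpha).

Fact incoming_proj_is_linear M i j (alpha : arrow j i) :
  linear (@incoming_proj M i j alpha).
Proof. by move=> c x y; rewrite /incoming_proj dsumP. Qed.

HB.instance Definition _ M i j (alpha : arrow j i) :=
  GRing.isLinear.Build K (incoming_sum M i) (M j) _ (@incoming_proj M i j alpha)
    (@incoming_proj_is_linear M i j alpha).

(* The map, on the kernel at i, of the arrow i -> j that reverses alpha. *)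
Definition incoming_ker_proj M i j (alpha : arrow j i) :
    'Hom(subvs_of (incoming_ker M i), M j) :=
  (linfun (@incoming_proj M i j alpha) \o linfun vsval)%VF.

Lemma incoming_kerE M i (x : incoming_sum M i) :
  (x \in incoming_ker M i) = (incoming_map x == 0).
Proof. by rewrite memv_ker lfunE. Qed.

Lemma incoming_ker_projE M i j (alpha : arrow j i)
    (x : subvs_of (incoming_ker M i)) :
  incoming_ker_proj M alpha x = vsval x (Tagged (fun j => arrow j i) alpha).
Proof. by rewrite comp_lfunE !lfunE. Qed.

(* The spaces and arrows are indexed by the outcomes bi, bj of the tests i == a
   and j == a, so that no transport along i = a is needed: incoming_ker M i is
   used only for i = a. *)
Definition reflected_space_case M i (bi : bool) : vectType K :=
  if bi then (subvs_of (incoming_ker M i) : vectType K) else space_at M i.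

(* If a is a sink, no arrow of the reflected quiver ends at a, and the value 0
   in the cases with bj = true is never used. *)
Definition reflected_map_case M i j (bi bj : bool) :
    (if bi || bj then arrow j i else arrow i j) ->
    'Hom(reflected_space_case M i bi, reflected_space_case M j bj) :=
  match bi, bj with
  | true, false => @incoming_ker_proj M i j
  | false, false => @map_of K Q M i j
  | _, true => fun=> 0
  end.

Definition reflected_rep a M : representation K (reflected_quiver a) :=
  @Representation K (reflected_quiver a)
    (fun i => reflected_space_case M i (i == a))
    (fun i j => @reflected_map_case M i j (i == a) (j == a)).

Definition reflected_filtration a nu M (d : 'I_nu.+1 -> dimvec Q) :
    'I_nu.+1 -> dimvec (reflected_quiver a) :=
  fun k => if k == ord0 then 0
           else if k == ord_max then dim_vec (reflected_rep a M)
           else sigma a (d k) + unit_vec a *~ r_plus a d k.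

End Reflection.

(* Main.v *)
(* Both varieties fibre over the flags away from a, since reflecting changes only
   the vertex a. Let V^k be the sum of the U^k_j over the arrows j -> a, inside the
   source of phi : V -> M_a, and N = ker phi. The fibre on the side of M consists of
   the flags W^k of M_a of dimensions d^k_a with phi(V^k) <= W^k; on the reflected
   side it consists of the flags N^k of N with N^k <= N \cap V^k, of dimensions
   max_(j <= k) (dim V^j - d^j_a) for k < nu. Choosing the W^k from the top down and
   the N^k from the bottom up, every step has 1 mod q solutions provided the
   dimensions allow one. So each fibre is empty or of cardinality 1 mod q, and since
   dim phi(V^k) + dim (N \cap V^k) = dim V^k both are nonempty exactly when
   dim phi(V^k) <= d^k_a for all k. *)

Require Import Defs.
From HB Require Import structures.
From mathcomp Require Import all_boot all_order all_algebra.
From mathcomp Require Import finfield zify.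

Set Implicit Arguments.
Unset Strict Implicit.
Unset Printing Implicit Defensive.

Import Order.TTheory GRing.Theory Num.Theory.
Local Open Scope ring_scope.

(** * Subspaces of given dimension between two subspaces: existence, and count modulo [q] *)

Lemma eq_sum_mod q (I : Type) (r : seq I) (P : pred I) (f g : I -> nat) :
  (forall i, P i -> f i = g i %[mod q]) ->
  (\sum_(i <- r | P i) f i = \sum_(i <- r | P i) g i %[mod q])%N.
Proof.
move=> fg; elim/big_rec2: _ => // i x y Pi xy.
by rewrite -modnDm xy fg // modnDm.
Qed.

Section Between.
Variables (K : fieldType) (V : vectType K).
Implicit Types (L A F : {vspace V}) (x : V) (e : nat).

Lemma dim_addv_line L x : x \notin L -> \dim (L + <[x]>) = (\dim L).+1.
Proof.
move=> xNL; have x0 : x != 0 by apply: contraNneq xNL => ->; rewrite mem0v.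
rewrite dimv_disjoint_sum ?dim_vline ?x0 ?addn1 //.
apply/eqP; rewrite -subv0; apply/subvP=> y /memv_capP[yL /vlineP[c yE]].
have [c0|c0] := eqVneq c 0; first by rewrite yE c0 scale0r mem0v.
by case/negP: xNL; rewrite -[x](scalerK c0) -yE memvZ.
Qed.

Lemma addv_line_between L F x :
  (L <= F)%VS -> \dim F = (\dim L).+1 -> x \notin L ->
  (x \in F) = (L + <[x]> == F)%VS.
Proof.
move=> LF dF xNL; rewrite eqEdim dim_addv_line // dF leqnn andbT.
by rewrite subv_add LF -memvE.
Qed.

Lemma exists_between L A e :
  (L <= A)%VS -> (\dim L <= e <= \dim A)%N ->
  exists F, [&& (L <= F)%VS, (F <= A)%VS & \dim F == e].
Proof.
move=> LA /andP[]; have [n] := ubnP (e - \dim L)%N.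
elim: n L LA => // n IHn L LA lt_n; rewrite leq_eqVlt => /predU1P[<- _|Le eA].
  by exists L; rewrite subvv LA eqxx.
have /subvPn[x xA xNL] : ~~ (A <= L)%VS.
  by apply/negP => /dimvS; rewrite leqNgt (leq_trans Le eA).
have [F /and3P[LF FA dF]] : exists F,
    [&& (L + <[x]> <= F)%VS, (F <= A)%VS & \dim F == e].
  apply: IHn; rewrite ?subv_add ?LA -?memvE ?dim_addv_line //.
  by rewrite subnS; lia.
by exists F; rewrite FA dF (subv_trans (addvSl _ _) LF).
Qed.

End Between.

(* card_vspace expects an explicit pack, and Vector.type has no eta rule. *)
Lemma card_mem_vspace (K : finFieldType) (V : vectType K) (A : {vspace V}) :
  #|[pred x : finvect_type V | x \in A]| = (#|K| ^ \dim A)%N.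
Proof.
by case: V A => T c A; exact: (@card_vspace K (finvect_type (Vector.Pack c)) c A).
Qed.

Section CardBetween.
Variables (K : finFieldType) (V : vectType K).
Implicit Types (L A F : {vspace V}) (e : nat).
Local Notation q := #|K|.

Lemma card_diffv L F : (L <= F)%VS ->
  #|[pred x : finvect_type V | (x \in F) && (x \notin L)]|
    = (q ^ \dim F - q ^ \dim L)%N.
Proof.
move=> LF; rewrite -!card_mem_vspace -[X in (X - _)%N](cardID [pred x : finvect_type V | x \in L]).
rewrite (@eq_card _ [predI _ & _] [pred x : finvect_type V | x \in L]).
  by rewrite addKn; apply: eq_card => x; rewrite !inE andbC.
by move=> x; rewrite !inE andb_idl // => /(subvP LF).
Qed.

(** Every vector of [A] outside [L] spans together with [L] exactly one cover of [L], and a cover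
    [F] arises in this way from the [q ^ (l + 1) - q ^ l] vectors of [F] outside [L], where l = dim
    L. With m = dim A the count is thus 1 + q + ... + q^(m - l - 1). *)
Lemma card_cover L A : (L <= A)%VS -> (\dim L < \dim A)%N ->
  #|[pred F | [&& (L <= F)%VS, (F <= A)%VS & \dim F == (\dim L).+1]]|
    = 1 %[mod q].
Proof.
move=> LA ltLA; set C := [pred F | _].
have q_gt1 : (1 < q)%N := finNzRing_gt1 K.
have ql_gt0 : (0 < q ^ \dim L)%N by rewrite expn_gt0 (ltnW q_gt1).
have : (#|C| * (q ^ (\dim L).+1 - q ^ \dim L) = q ^ \dim A - q ^ \dim L)%N.
  rewrite -card_diffv // -[RHS]sum1_card.
  pose p (x : finvect_type V) : {vspace V} := (L + <[x : V]>)%VS.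
  rewrite (partition_big p (mem C)) /= => [|x /andP[xA xNL]]; last first.
    by rewrite !inE addvSl subv_add LA -memvE xA dim_addv_line //=.
  rewrite -sum_nat_const; apply: eq_bigr => F /and3P[LF FA /eqP dF].
  rewrite sum1_card -dF -card_diffv //; apply: eq_card => x; rewrite !inE.
  apply/andP/andP => [[xF xNL]|[/andP[_ xNL] pF]]; split => //.
  - by apply/andP; split=> //; apply: (subvP FA).
  - exact: (etrans (esym (addv_line_between LF dF xNL)) xF).
  - exact: (etrans (addv_line_between LF dF xNL) pF).
rewrite -[in RHS](subnK (ltnW ltLA)) expnS expnD.
rewrite -[X in (_ * (_ - X))%N]mul1n -[X in (_ = _ - X)%N]mul1n -!mulnBl mulnA.
move/eqP; rewrite eqn_pmul2r // => /eqP; rewrite -(subnSK ltLA) expnS => E.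
(* The relation [#|C| * (q - 1) = q * u - 1], with [u] a power of [q], is rewritten without
   subtraction, so that reduction modulo [q] isolates [#|C|]. *)
have {E} : (#|C| * q + 1 = q * q ^ (\dim A - (\dim L).+1) + #|C|)%N.
  move: E; have := expn_gt0 q (\dim A - (\dim L).+1); rewrite (ltnW q_gt1) /=.
  move: (q ^ _)%N #|C| => u c u0; case: (q) q_gt1 => // r _.
  by rewrite subn1 /= mulnS => ->; nia.
by move/(congr1 (modn^~ q)); rewrite modnMDl [(q * _)%N]mulnC modnMDl.
Qed.

(* Both ends are counted through the pairs (F, L') where L' covers L and L' <= F:
   the number of covers of L in any larger space is 1 mod q. *)
Lemma card_between L A e :
  (L <= A)%VS -> (\dim L <= e <= \dim A)%N ->
  #|[pred F | [&& (L <= F)%VS, (F <= A)%VS & \dim F == e]]| = 1 %[mod q].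
Proof.
move=> LA /andP[]; have [n] := ubnP (e - \dim L)%N.
elim: n L LA => // n IHn L LA lt_n; rewrite leq_eqVlt => /predU1P[<- _|Le eA].
  rewrite (@eq_card1 _ L) // => F; rewrite !inE.
  apply/and3P/eqP => [[LF _ dF]|->]; last by rewrite subvv LA eqxx.
  by apply/esym/eqP; rewrite eqEdim LF (eqP dF) leqnn.
set P := fun F : {vspace V} => [&& (L <= F)%VS, (F <= A)%VS & \dim F == e].
pose C F := [pred L' | [&& (L <= L')%VS, (L' <= F)%VS & \dim L' == (\dim L).+1]].
transitivity ((\sum_(F | P F) #|C F|) %% q)%N.
  rewrite -sum1_card; apply: eq_sum_mod => F /and3P[LF FA /eqP dF].
  by rewrite card_cover // dF.
have -> : (\sum_(F | P F) #|C F| =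
    \sum_(L' | L' \in C A) #|[pred F | [&& (L' <= F)%VS, (F <= A)%VS & \dim F == e]]|)%N.
  under eq_bigr do rewrite -sum1_card.
  rewrite (exchange_big_dep (mem (C A))) /= => [|F L' /and3P[_ FA _] /and3P[LL L'F dL']].
    apply: eq_bigr => L' /and3P[LL L'A dL']; rewrite -sum1_card.
    apply: eq_bigl => F; rewrite !inE /P LL dL' andbT.
    case: (boolP (L' <= F)%VS) => [L'F|]; rewrite ?andbF // andbT.
    by rewrite (subv_trans LL L'F) andbT.
  by rewrite /C !inE LL dL' (subv_trans L'F FA).
rewrite -(card_cover LA (leq_trans Le eA)) -[in RHS]sum1_card.
apply: eq_sum_mod => L' /and3P[LL L'A /eqP dL']; apply: IHn; rewrite ?dL' //.
by rewrite subnS; lia.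
Qed.

End CardBetween.

(** * Chains for a transitive relation, built and counted term by term *)

Section Chains.
Variables (T : Type) (le : rel T).
Hypothesis le_trans : transitive le.

(** All pairs of terms are compared, and [x] bounds every term, so that removing the first term [y]
    leaves a condition of the same form with [y] as the new bound ([chain_above_cons]). *)
Definition chain_above n (c : 'I_n -> pred T) (x : T) : pred {ffun 'I_n -> T} :=
  fun F => [forall k, le x (F k) && c k (F k)] &&
    [forall k : 'I_n, forall l : 'I_n, (k < l)%N ==> le (F k) (F l)].

Definition ffun_cons n (y : T) (F : {ffun 'I_n -> T}) : {ffun 'I_n.+1 -> T} :=
  [ffun i => oapp F y (unlift ord0 i)].

Lemma ffun_cons0 n y (F : {ffun 'I_n -> T}) : ffun_cons y F ord0 = y.
Proof. by rewrite ffunE unlift_none. Qed.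

Lemma ffun_consS n y (F : {ffun 'I_n -> T}) k :
  ffun_cons y F (lift ord0 k) = F k.
Proof. by rewrite ffunE liftK. Qed.

Lemma forall_ord_recl n (P : pred 'I_n.+1) :
  [forall k, P k] = P ord0 && [forall k, P (lift ord0 k)].
Proof.
apply/forallP/andP => [PT|[P0 /forallP PS] k].
  by split=> //; apply/forallP.
by case: (unliftP ord0 k) => [j|] ->.
Qed.

Lemma chain_above_cons n (c : 'I_n.+1 -> pred T) x y F :
  chain_above c x (ffun_cons y F) =
    [&& le x y, c ord0 y & chain_above (fun k => c (lift ord0 k)) y F].
Proof.
rewrite /chain_above !forall_ord_recl ffun_cons0 /= -andbA.
case xy: (le x y) => //=; case: (c ord0 y) => //=.
apply/and3P/andP => [[/forallP xc /forallP y_le /forallP F_le]|].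
  split; apply/forallP=> k.
    have := y_le k; rewrite ffun_consS => ->.
    by have := xc k; rewrite ffun_consS => /andP[].
  apply/forallP=> l; have /forallP/(_ (lift ord0 l)) := F_le k.
  by rewrite !ffun_consS.
move=> [/forallP yc /forallP F_le]; split; apply/forallP=> k.
- by rewrite ffun_consS; have /andP[/(le_trans xy)-> ->] := yc k.
- by rewrite ffun_consS; have /andP[-> _] := yc k.
apply/forallP=> l; case: (unliftP ord0 l) => [j|] -> //.
by rewrite !ffun_consS; have /forallP/(_ j) := F_le k.
Qed.

(** A greedy construction: [good k y] guarantees an admissible term number [k] beyond [y], and every
    admissible choice keeps all later positions good, so the construction never gets stuck. *)
Lemma exists_chain_above n (c : 'I_n -> pred T) (good : 'I_n -> T -> Prop) x :
  (forall k y, good k y -> exists z, le y z && c k z) ->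
  (forall (k l : 'I_n) y, (k < l)%N -> c k y -> good l y) ->
  (forall k, good k x) -> exists F, chain_above c x F.
Proof.
elim: n c good x => [|n IHn] c good x stepP goodP good_x.
  by exists [ffun=> x]; apply/andP; split; apply/forallP=> -[].
have [y /andP[xy cy]] := stepP _ _ (good_x ord0).
have [||k|F chF] := IHn (fun k => c (lift ord0 k)) (fun k => good (lift ord0 k)) y.
- by move=> k; apply: stepP.
- by move=> k l z kl; apply: (goodP (lift ord0 k) (lift ord0 l)).
- exact: goodP cy.
by exists (ffun_cons y F); rewrite chain_above_cons xy cy.
Qed.

End Chains.

(** The first term has 1 mod [q] choices, and by induction each choice has 1 mod [q] continuations.
    Only the residues of these numbers of continuations agree, so the sum over the first term is
    compared with a sum of ones. *)
Lemma card_chain_above q (T : finType) (le : rel T) n (c : 'I_n -> pred T)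
    (good : 'I_n -> T -> Prop) x :
  transitive le ->
  (forall k y, good k y -> #|[pred z | le y z && c k z]| = 1 %[mod q]) ->
  (forall (k l : 'I_n) y, (k < l)%N -> c k y -> good l y) ->
  (forall k, good k x) -> #|chain_above le c x| = 1 %[mod q].
Proof.
move=> le_trans; elim: n c good x => [|n IHn] c good x stepP goodP good_x.
  rewrite (@eq_card1 _ [ffun=> x]) // => F; rewrite unfold_in /= -[RHS]topredE /=.
  have -> : F = [ffun=> x] by apply/ffunP=> -[].
  by rewrite eqxx /chain_above; apply/andP; split; apply/forallP=> -[].
rewrite -sum1_card.
have bij_cons : bijective (fun p : T * {ffun 'I_n -> T} => ffun_cons p.1 p.2).
  exists (fun F : {ffun 'I_n.+1 -> T} => (F ord0, [ffun k => F (lift ord0 k)])).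
    by move=> [y F]; rewrite /= ffun_cons0; congr (_, _); apply/ffunP=> k;
       rewrite ffunE ffun_consS.
  move=> F; apply/ffunP=> k /=; case: (unliftP ord0 k) => [j|] ->.
    by rewrite ffun_consS ffunE.
  by rewrite ffun_cons0.
rewrite (reindex _ (onW_bij _ bij_cons)) /=.
pose c' (k : 'I_n) := c (lift ord0 k).
under eq_bigl => p do rewrite [_ \in _](chain_above_cons le_trans) andbA.
rewrite -(pair_big_dep (fun y => le x y && c ord0 y)
  (fun y F => chain_above le c' y F) (fun=> fun=> 1%N)) /=.
rewrite -(stepP _ _ (good_x ord0)) -sum1_card.
elim/big_rec2: _ => // y i j /andP[_ cy] ij; rewrite -modnDm ij -[in RHS]modnDm.
congr ((_ + _) %% _)%N; rewrite sum1_card.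
apply: (IHn c' (fun k => good (lift ord0 k))) => [k|k l z kl|k].
- exact: stepP.
- exact: (goodP (lift ord0 k) (lift ord0 l)).
- exact: goodP cy.
Qed.

Lemma monotone_ordP (T : Type) (r : rel T) n (F : 'I_n.+1 -> T) :
  reflexive r -> transitive r ->
  reflect (forall k l : 'I_n.+1, (k <= l)%N -> r (F k) (F l))
    [forall k : 'I_n, r (F (widen_ord (leqnSn n) k)) (F (lift ord0 k))].
Proof.
move=> r_refl r_trans; apply: (iffP forallP) => [r_adj k l kl | r_mono k].
  (* Truncating the index at [n] extends [F] to all natural numbers, constant from [n] on, so that
     [homo_leq] applies. *)
  pose f i := F (inord (minn i n)).
  have f_adj i : r (f i) (f i.+1).
    rewrite /f; case: (leqP n i) => [n_le|i_lt].
      by rewrite (minn_idPr (leqW n_le)).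
    rewrite (minn_idPl i_lt).
    have -> : inord i = widen_ord (leqnSn n) (Ordinal i_lt).
      by apply: val_inj; rewrite /= inordK // ltnW.
    have -> : inord i.+1 = lift ord0 (Ordinal i_lt) :> 'I_n.+1.
      by apply: val_inj; rewrite /= inordK.
    exact: r_adj.
  have f_ord (i : 'I_n.+1) : f i = F i.
    by rewrite /f (minn_idPl _) -1?ltnS // inord_val.
  by rewrite -!f_ord; apply: (homo_leq (r := r)) kl.
by apply: r_mono; rewrite /= /bump; lia.
Qed.

(** * Flags of prescribed dimensions with each term bounded from one side *)

Section FlagFibres.
Variables (K : fieldType) (V : vectType K) (n : nat).
Implicit Types (A P : 'I_n.+1 -> {vspace V}) (e : 'I_n.+1 -> nat).
Implicit Types (F : {ffun 'I_n.+1 -> {vspace V}}) (k : 'I_n.+1) (X : {vspace V}).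

Definition nested F :=
  [forall k : 'I_n, (F (widen_ord (leqnSn n) k) <= F (lift ord0 k))%VS].

Definition flags_below A e : pred {ffun 'I_n.+1 -> {vspace V}} :=
  [pred F | [&& nested F, [forall k, \dim (F k) == e k] & [forall k, F k <= A k]%VS]].

Definition flags_above P e : pred {ffun 'I_n.+1 -> {vspace V}} :=
  [pred F | [&& nested F, [forall k, \dim (F k) == e k] & [forall k, P k <= F k]%VS]].

Definition below_pred A e k X := (X <= A k)%VS && (\dim X == e k).
(** The index is reversed because these flags are chosen from the top term down, as chains for
    reversed inclusion that start at [fullv]. *)
Definition above_pred P e k X :=
  (P (rev_ord k) <= X)%VS && (\dim X == e (rev_ord k)).

Lemma nestedP F :
  reflect (forall k l : 'I_n.+1, (k <= l)%N -> (F k <= F l)%VS) (nested F).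
Proof. exact: (monotone_ordP F (@subvv K V) (@subv_trans K V)). Qed.

Lemma flags_belowE A e : flags_below A e =1 chain_above subsetv (below_pred A e) 0%VS.
Proof.
move=> F; apply/and3P/andP=> [[/nestedP F_le /forallP dF /forallP FA]|].
  split; first by apply/forallP=> k; rewrite /below_pred sub0v FA dF.
  by apply/forallP=> k; apply/forallP=> l; apply/implyP=> /ltnW/F_le.
move=> [/forallP FA /forallP F_lt]; split.
- apply/nestedP=> k l; rewrite leq_eqVlt => /predU1P[/val_inj->|lt_kl].
    exact: subvv.
  by have /forallP/(_ l)/implyP/(_ lt_kl) := F_lt k.
- by apply/forallP=> k; have /and3P[] := FA k.
by apply/forallP=> k; have /and3P[] := FA k.
Qed.

Definition rev_flag F : {ffun 'I_n.+1 -> {vspace V}} := [ffun k => F (rev_ord k)].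

Lemma rev_flagK : involutive rev_flag.
Proof. by move=> F; apply/ffunP=> k; rewrite !ffunE rev_ordK. Qed.

Lemma flags_aboveE P e F : flags_above P e (rev_flag F) =
  chain_above (fun X Y => Y <= X)%VS (above_pred P e) fullv F.
Proof.
apply/and3P/andP=> [[/nestedP F_le /forallP dF /forallP PF]|].
  split.
    apply/forallP=> k; rewrite /above_pred subvf.
    by have := dF (rev_ord k); have := PF (rev_ord k); rewrite ffunE rev_ordK => -> ->.
  apply/forallP=> k; apply/forallP=> l; apply/implyP=> lt_kl.
  have := F_le (rev_ord l) (rev_ord k); rewrite !ffunE !rev_ordK; apply.
  by rewrite /=; lia.
move=> [/forallP PF /forallP F_lt]; split.
- apply/nestedP=> k l; rewrite leq_eqVlt => /predU1P[/val_inj->|lt_kl].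
    exact: subvv.
  have /forallP/(_ (rev_ord k))/implyP := F_lt (rev_ord l).
  by rewrite !ffunE; apply; rewrite /=; have := ltn_ord l; lia.
- by apply/forallP=> k; have /and3P[_ _] := PF (rev_ord k); rewrite ffunE rev_ordK.
by apply/forallP=> k; have /and3P[_] := PF (rev_ord k); rewrite ffunE rev_ordK.
Qed.

Definition le_mono e := forall k l : 'I_n.+1, (k <= l)%N -> (e k <= e l)%N.
Definition sub_mono A := forall k l : 'I_n.+1, (k <= l)%N -> (A k <= A l)%VS.

(** These are the conditions on the term [X] chosen last under which [exists_between] and
    [card_between] apply to the next one: between [X] and [A k] going up, between [P (rev_ord k)]
    and [X] going down. *)
Definition below_good A e k X := (X <= A k)%VS /\ (\dim X <= e k)%N.
Definition above_good P e k X := (P (rev_ord k) <= X)%VS /\ (e (rev_ord k) <= \dim X)%N.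

Lemma below_goodP A e (k l : 'I_n.+1) X : sub_mono A -> le_mono e -> (k < l)%N ->
  below_pred A e k X -> below_good A e l X.
Proof.
move=> A_mono e_mono lt_kl /andP[FA /eqP dF].
by split; [apply: subv_trans FA (A_mono _ _ (ltnW lt_kl)) | rewrite dF e_mono // ltnW].
Qed.

Lemma above_goodP P e (k l : 'I_n.+1) X : sub_mono P -> le_mono e -> (k < l)%N ->
  above_pred P e k X -> above_good P e l X.
Proof.
move=> P_mono e_mono lt_kl /andP[PF /eqP dF].
have lt_rev : (rev_ord l <= rev_ord k)%N by rewrite /=; lia.
by split; [apply: subv_trans (P_mono _ _ lt_rev) PF | rewrite dF e_mono].
Qed.

Lemma exists_flags_below A e : sub_mono A -> le_mono e ->
  (forall k, (e k <= \dim (A k))%N) -> exists F, flags_below A e F.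
Proof.
move=> A_mono e_mono e_le.
have [|k l F|k|F chF] := @exists_chain_above _ subsetv (@subv_trans K V) n.+1 (below_pred A e)
  (below_good A e) 0%VS.
- move=> k X [XA dX]; have [|F /and3P[XF FA dF]] := exists_between XA (e := e k).
    by rewrite dX e_le.
  by exists F; rewrite XF /below_pred FA.
- exact: below_goodP.
- by split; rewrite ?sub0v ?dimv0.
by exists F; rewrite flags_belowE.
Qed.

Lemma exists_flags_above P e : sub_mono P -> le_mono e ->
  (forall k, (\dim (P k) <= e k <= \dim {: V})%N) -> exists F, flags_above P e F.
Proof.
move=> P_mono e_mono e_bd.
have [X Y Z XY YZ||k l F|k|F chF] := @exists_chain_above _ (fun X Y => Y <= X)%VS _
  n.+1 (above_pred P e) (above_good P e) fullv.
- exact: subv_trans YZ XY.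
- move=> k X [PX dX]; have [|F /and3P[PF FX dF]] := exists_between PX (e := e (rev_ord k)).
    by rewrite dX; case/andP: (e_bd (rev_ord k)) => ->.
  by exists F; rewrite FX /above_pred PF.
- exact: above_goodP.
- by split; rewrite ?subvf //; case/andP: (e_bd (rev_ord k)).
by exists (rev_flag F); rewrite flags_aboveE.
Qed.

End FlagFibres.
Section CardFlagFibres.
Variables (K : finFieldType) (V : vectType K) (n : nat).
Implicit Types (A P : 'I_n.+1 -> {vspace V}) (e : 'I_n.+1 -> nat).

Lemma card_flags_below A e :
  (forall k l : 'I_n.+1, (k <= l)%N -> (A k <= A l)%VS) ->
  (forall k l : 'I_n.+1, (k <= l)%N -> (e k <= e l)%N) ->
  (forall k, (e k <= \dim (A k))%N) -> #|flags_below A e| = 1 %[mod #|K|].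
Proof.
move=> A_mono e_mono e_le; rewrite (eq_card (flags_belowE _ _)).
apply: (card_chain_above (good := below_good A e)).
- exact: subv_trans.
- move=> k X [XA dX]; apply: card_between => //; by rewrite dX e_le.
- by move=> k l F; apply: below_goodP.
- by split; rewrite ?sub0v ?dimv0.
Qed.

Lemma card_flags_above P e :
  (forall k l : 'I_n.+1, (k <= l)%N -> (P k <= P l)%VS) ->
  (forall k l : 'I_n.+1, (k <= l)%N -> (e k <= e l)%N) ->
  (forall k, (\dim (P k) <= e k <= \dim {: V})%N) ->
  #|flags_above P e| = 1 %[mod #|K|].
Proof.
move=> P_mono e_mono e_bd.
rewrite -(on_card_preimset (onW_bij _ (inv_bij (@rev_flagK K V n)))).
have /eq_card-> : [set F | rev_flag F \in flags_above P e] =i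
  chain_above (fun X Y => Y <= X)%VS (above_pred P e) fullv.
  by move=> F; rewrite inE; apply: flags_aboveE.
apply: (card_chain_above (good := above_good P e)).
- by move=> X Y Z XY YZ; apply: subv_trans YZ XY.
- move=> k X [PX dX].
  rewrite -(card_between PX (e := e (rev_ord k))); last first.
    by rewrite dX; case/andP: (e_bd (rev_ord k)) => ->.
  by congr (_ %% _)%N; apply: eq_card => F; rewrite !inE /above_pred andbCA.
- by move=> k l F; apply: above_goodP.
- by split; rewrite ?subvf //; case/andP: (e_bd (rev_ord k)).
Qed.

End CardFlagFibres.

(** * Subspaces of a direct sum given by their components *)

Section DirectSumSubspaces.
Variables (K : fieldType) (I : finType) (V : I -> vectType K).

Definition dsum_in i (x : V i) : dsum V := [ffun j => dfwith (fun j => 0 : V j) x j].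

Lemma dsum_in_eq i (x : V i) : dsum_in x i = x.
Proof. by rewrite ffunE dfwith_in. Qed.

Lemma dsum_in_neq i j (x : V i) : i != j -> dsum_in x j = 0.
Proof. by move=> ij; rewrite ffunE dfwith_out. Qed.

Fact dsum_in_is_linear i : linear (@dsum_in i).
Proof.
move=> c x y; apply/ffunP=> j; rewrite dsumP.
have [<-|ij] := eqVneq i j; first by rewrite !dsum_in_eq.
by rewrite !dsum_in_neq // scaler0 addr0.
Qed.

HB.instance Definition _ i :=
  GRing.isLinear.Build K (V i) (dsum V) _ (@dsum_in i) (@dsum_in_is_linear i).

Lemma dsum_sumE (J : Type) (r : seq J) (P : pred J) (f : J -> dsum V) i :
  (\sum_(j <- r | P j) f j) i = \sum_(j <- r | P j) f j i.
Proof.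
by elim/big_rec2: _ => [|j x y _ <-]; rewrite ffunE.
Qed.

Lemma dsum_in_sum (f : dsum V) : f = \sum_i dsum_in (f i).
Proof.
apply/ffunP=> i; rewrite dsum_sumE (bigD1 i) //= dsum_in_eq big1 ?addr0 // => j ij.
exact: dsum_in_neq.
Qed.

(** The direct sum of the [S i], encoded as a sum of images so that its dimension follows from
    directness. Membership is componentwise by [mem_dsum_sub]. *)
Definition dsum_sub (S : forall i, {vspace V i}) : {vspace dsum V} :=
  (\sum_i (linfun (@dsum_in i) @: S i))%VS.

Lemma mem_dsum_sub S (f : dsum V) : (f \in dsum_sub S) = [forall i, f i \in S i].
Proof.
apply/memv_sumP/forallP => [[g gS ->] i|fS].
  rewrite dsum_sumE (bigD1 i) //= memvD //.
    by have /memv_imgP[x xS ->] := gS i isT; rewrite lfunE /= dsum_in_eq.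
  rewrite memv_suml // => j ji.
  by have /memv_imgP[x xS ->] := gS j isT; rewrite lfunE /= dsum_in_neq ?mem0v.
exists (fun i => dsum_in (f i)) => [i _|]; last exact: dsum_in_sum.
by apply/memv_imgP; exists (f i); rewrite ?lfunE.
Qed.

Lemma dim_dsum_sub S : \dim (dsum_sub S) = (\sum_i \dim (S i))%N.
Proof.
have /directvP/= -> : directv (\sum_i (linfun (@dsum_in i) @: S i)).
  apply/directv_sum_independent => u uS u0 i _.
  have /(congr1 (fun f : dsum V => f i)) := u0.
  rewrite dsum_sumE (bigD1 i) //= big1 => [|j ji].
    have /memv_imgP[x xS ->] := uS i isT.
    by rewrite lfunE /= dsum_in_eq addr0 ffunE => ->; rewrite linear0.
  by have /memv_imgP[x xS ->] := uS j isT; rewrite lfunE /= dsum_in_neq.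
apply: eq_bigr => i _; apply: limg_dim_eq; apply/eqP; rewrite -subv0.
apply/subvP=> x; rewrite memv_cap memv_ker lfunE memv0 => /andP[_ /eqP x0].
by rewrite -[x]dsum_in_eq x0 ffunE.
Qed.

Lemma dsum_sub_mono S S' :
  (forall i, S i <= S' i)%VS -> (dsum_sub S <= dsum_sub S')%VS.
Proof.
move=> SS'; apply/subvP=> f; rewrite !mem_dsum_sub => /forallP fS.
by apply/forallP=> i; apply: (subvP (SS' i)).
Qed.

End DirectSumSubspaces.

(** * Separating the component at one index from the others *)

Section PutAt.
Variables (I : finType) (a : I) (n : nat).

Definition put_at (T : I -> Type) (B : {ffun 'I_n -> {dffun forall i, T i}})
    (F : {ffun 'I_n -> T a}) : {ffun 'I_n -> {dffun forall i, T i}} :=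
  [ffun k => [ffun i => dfwith (B k) (F k) i]].

Lemma put_at_in T B F k : @put_at T B F k a = F k.
Proof. by rewrite !ffunE dfwith_in. Qed.

Lemma put_at_out T B F k i : i != a -> @put_at T B F k i = B k i.
Proof. by move=> ia; rewrite !ffunE dfwith_out // eq_sym. Qed.

Lemma put_atP T (B U : {ffun 'I_n -> {dffun forall i, T i}}) (F : {ffun 'I_n -> T a}) :
  (forall k i, i != a -> U k i = B k i) -> (forall k, U k a = F k) ->
  U = put_at B F.
Proof.
move=> UB UF; apply/ffunP=> k; apply/ffunP=> i.
have [->|ia] := eqVneq i a; first by rewrite put_at_in.
by rewrite put_at_out ?UB.
Qed.

Lemma put_at_inj T B : injective (@put_at T B).
Proof.
by move=> F G eqFG; apply/ffunP=> k; rewrite -(put_at_in B F) eqFG put_at_in.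
Qed.

(** Families are grouped by their components away from [a]. Each group is represented once, by its
    member [B] whose component at [a] is the constant [c]. *)
Lemma card_put_at (T : I -> finType) (c : T a)
    (P : pred {ffun 'I_n -> {dffun forall i, T i}}) :
  #|P| = (\sum_(B : {ffun 'I_n -> {dffun forall i, T i}} | [forall k, B k a == c])
           #|[pred F | P (put_at B F)]|)%N.
Proof.
rewrite -sum1_card (partition_big (fun U => put_at U [ffun=> c])
  (fun B : {ffun 'I_n -> {dffun forall i, T i}} => [forall k, B k a == c])) /=; last first.
  by move=> U _; apply/forallP=> k; rewrite put_at_in ffunE.
apply: eq_bigr => B /forallP Bc; rewrite sum1_card -(card_image (@put_at_inj _ B)).
apply: eq_card => U; apply/andP/imageP => [[PU /eqP UB]|[F PF ->]].
  have defU : U = put_at B [ffun k => U k a].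
    apply: put_atP => [k i ia|k]; last by rewrite ffunE.
    by rewrite -UB put_at_out.
  by exists [ffun k => U k a]; rewrite // inE -defU.
split=> //; apply/eqP/esym; apply: put_atP => k => [i ia|].
  by rewrite put_at_out.
by rewrite ffunE; apply/eqP.
Qed.

End PutAt.

(** * The sum of the spaces at the sources of the arrows into [a], and its map to [M a] *)

Section IncomingSubspaces.
Variables (K : fieldType) (Q : quiver) (a : Q) (M : representation K Q).
Implicit Types S : subspaces M.

(** For [S] the k-th term of a flag this is the space [V^k]. *)
Definition incoming_sub S : {vspace incoming_sum M a} :=
  dsum_sub (fun s : arrows_to a => S (tag s)).

Lemma dim_incoming_sub S :
  \dim (incoming_sub S) = (\sum_(s : arrows_to a) \dim (S (tag s)))%N.
Proof. exact: dim_dsum_sub. Qed.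

Local Notation at_arrow s := (@dsum_in K _ (fun s : arrows_to a => M (tag s)) s).

Lemma incoming_map_in (s : arrows_to a) (x : M (tag s)) :
  incoming_map (at_arrow s x) = map_of M (tagged s) x.
Proof.
rewrite /incoming_map (bigD1 s) //= dsum_in_eq big1 ?addr0 // => t ts.
by rewrite dsum_in_neq ?linear0 // eq_sym.
Qed.

(** The image of a direct sum is the sum of the images of its summands, here the images along the
    single arrows. Stability under all arrows into [a] thus becomes one inclusion, phi(V) <= W. *)
Lemma incoming_map_subP S (W : {vspace M a}) :
  reflect (forall j (alpha : arrow j a), (map_of M alpha @: S j <= W)%VS)
          (linfun (@incoming_map K Q M a) @: incoming_sub S <= W)%VS.
Proof.
have imgE (s : arrows_to a) : (linfun (@incoming_map K Q M a) @: (linfun (at_arrow s) @: S (tag s))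
    = map_of M (tagged s) @: S (tag s))%VS.
  rewrite -limg_comp; apply: eq_in_limg => x _.
  rewrite comp_lfunE lfunE -incoming_map_in; congr (incoming_map _).
  exact: (lfunE (at_arrow s)).
have -> : (linfun (@incoming_map K Q M a) @: incoming_sub S =
    \sum_s linfun (@incoming_map K Q M a) @: (linfun (at_arrow s) @: S (tag s)))%VS.
  exact: limg_sum.
apply: (iffP subv_sumP) => [SW j alpha|SW s _].
  by have := SW (Tagged (fun j => arrow j a) alpha) isT; rewrite imgE.
by rewrite imgE; case: s.
Qed.

(** The reflected space at [a] is indexed by the test [a == a], which does not reduce to [true].
    With an arbitrary boolean [b] the kernel inclusion is typed without transport, and a case
    analysis on [b] computes it. *)
Definition incl_case i (b : bool) : 'Hom(reflected_space_case M i b, incoming_sum M i) :=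
  match b with
  | true => linfun (vsval : subvs_of (incoming_ker M i) -> incoming_sum M i)
  | false => 0
  end.

Lemma lker_incl_case i (b : bool) : b -> lker (@incl_case i b) = 0%VS.
Proof.
case: b => // _; apply/eqP; rewrite -subv0; apply/subvP => x.
rewrite memv_ker lfunE memv0 => /eqP x0; apply/eqP/val_inj.
by rewrite /= x0.
Qed.

Lemma limg_incl_case i (b : bool) : b -> limg (@incl_case i b) = incoming_ker M i.
Proof.
case: b => // _; apply/vspaceP=> x; apply/memv_imgP/idP => [[y _ ->]|xN].
  by rewrite lfunE; apply: subvsP.
by exists (vsproj (incoming_ker M i) x); rewrite ?memvf // lfunE /= vsprojK.
Qed.

(** Rank-nullity for phi on [U]: the inclusion of the kernel N is injective, so the preimage of [U]
    has the dimension of the intersection of [U] with N. *)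
Lemma dim_incl_preim (b : bool) (U : {vspace incoming_sum M a}) : b ->
  (\dim (@incl_case a b @^-1: U) +
   \dim (linfun (@incoming_map K Q M a) @: U) = \dim U)%N.
Proof.
move=> bT; rewrite -(limg_ker_dim (linfun (@incoming_map K Q M a)) U).
congr (_ + _)%N; rewrite -lpreim_cap_limg -(limg_dim_eq (f := incl_case a b)).
  by rewrite lpreimK ?capvSr // limg_incl_case.
by rewrite lker_incl_case // capv0.
Qed.

End IncomingSubspaces.

Lemma is_subrepP (K : fieldType) (Q : quiver) (M : representation K Q) (U : subspaces M) :
  reflect (forall i j (alpha : arrow i j), (map_of M alpha @: U i <= U j)%VS)
          (is_subrep U).
Proof.
apply: (iffP forallP) => [subU i j alpha|subU i].
  by have /forallP/(_ j)/forallP := subU i; apply.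
by apply/forallP=> j; apply/forallP.
Qed.

Lemma is_filtration_ge0 (Q : quiver) nu (d : 'I_nu.+1 -> dimvec Q) k i :
  is_filtration d -> 0 <= d k i.
Proof.
move=> /andP[/eqP d0 /forallP d_mono].
have <- : d ord0 i = 0 by rewrite d0 ffunE.
apply: (monotone_ordP (fun k => d k i) lexx le_trans) => //.
by apply/forallP=> l; have /forallP := d_mono l.
Qed.

(** * The fibres of both flag varieties over the flags away from [a] *)

Section Fibres.
Variables (K : fieldType) (Q : quiver) (a : Q) (M : representation K Q).
Variables (nu : nat) (d : 'I_nu.+1 -> dimvec Q).
Hypothesis a_sink : is_sink a.
Implicit Types (B : flag_type nu M) (k l : 'I_nu.+1).

Let no_arrow j (alpha : arrow a j) : False.
Proof. by have := a_sink j; rewrite (cardD1 alpha). Qed.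

Let no_loop j (alpha : arrow j a) : j != a.
Proof. by apply/eqP=> ja; move: alpha; rewrite ja => /no_arrow. Qed.

(* The conditions of Fl M d that do not involve the vertex a. *)
Definition flag_away B : bool :=
  [&& [forall k, forall i : Q, forall j : Q, forall alpha : arrow i j,
        (i != a) && (j != a) ==> (map_of M alpha @: B k i <= B k j)%VS],
      [forall k, forall i : Q, (i != a) ==> ((\dim (B k i))%:Z == d k i)],
      [forall k : 'I_nu, forall i : Q, (i != a) ==>
        (B (widen_ord (leqnSn nu) k) i <= B (lift ord0 k) i)%VS] &
      [forall i, (i != a) ==> (B ord_max i == fullv)]].

Definition sink_image B k : {vspace M a} :=
  (linfun (@incoming_map K Q M a) @: incoming_sub a (B k))%VS.

(** The intersection of N and [V^k], taken as a preimage so that it lives in the reflected space at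
    [a]. *)
Definition sink_kernel B k : {vspace reflected_rep a M a} :=
  (incl_case M a (a == a) @^-1: incoming_sub a (B k))%VS.

Lemma flag_awayP B :
  reflect [/\ forall k i j (alpha : arrow i j), i != a -> j != a ->
                 (map_of M alpha @: B k i <= B k j)%VS,
               forall k i, i != a -> (\dim (B k i))%:Z = d k i,
               forall (k : 'I_nu) i, i != a ->
                 (B (widen_ord (leqnSn nu) k) i <= B (lift ord0 k) i)%VS &
               forall i, i != a -> B ord_max i = fullv]
          (flag_away B).
Proof.
apply: (iffP and4P) => -[subB dimB nestB topB]; split.
- move=> k i j alpha ia ja; move/forallP/(_ k)/forallP/(_ i): subB.
  by move/forallP/(_ j)/forallP/(_ alpha); rewrite ia ja.
- by move=> k i ia; apply/eqP; move/forallP/(_ k)/forallP/(_ i)/implyP: dimB; apply.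
- by move=> k i; move/forallP/(_ k)/forallP/(_ i)/implyP: nestB; apply.
- by move=> i ia; apply/eqP; move/forallP/(_ i)/implyP: topB; apply.
- do 4![apply/forallP=> ?]; apply/implyP=> /andP[]; exact: subB.
- by do 2![apply/forallP=> ?]; apply/implyP=> ia; rewrite dimB.
- by do 2![apply/forallP=> ?]; apply/implyP=> ia; apply: nestB.
- by apply/forallP=> ?; apply/implyP=> ia; rewrite topB.
Qed.

Local Arguments is_filtration_of : simpl never.
Local Arguments is_subrep : simpl never.

(** Since [a] is a sink, the arrows at [a] all end there, and by [incoming_map_subP] they only
    require phi(V^k) <= W^k, where [W^k] is [F k]. *)
Lemma Fl_put_at B (F : {ffun 'I_nu.+1 -> {vspace M a}}) :
  is_filtration_of M d ->
  Fl M d (put_at (B : {ffun 'I_nu.+1 -> {dffun forall i, {vspace M i}}}) F) =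
  flag_away B && flags_above (sink_image B) (fun k => `|d k a|%N) F.
Proof.
move=> dM; rewrite /Fl /= dM /=; set U := put_at _ _.
have UaE k : U k a = F k by apply: put_at_in.
have UE k i : i != a -> U k i = B k i by apply: put_at_out.
have d_ge0 k : `|d k a|%N%:Z = d k a.
  by rewrite gez0_abs // is_filtration_ge0 //; case/andP: dM.
apply/and4P/andP => [[/forallP subU /forallP dimU /forallP nestU /forallP topU]|].
  split; [apply/flag_awayP; split | apply/and3P; split].
  - by move=> k i j alpha ia ja; have /is_subrepP := subU k; rewrite -!UE //; apply.
  - by move=> k i ia; have /forallP/(_ i)/eqP := dimU k; rewrite UE.
  - by move=> k i ia; have /forallP/(_ i) := nestU k; rewrite !UE.
  - by move=> i ia; have /eqP := topU i; rewrite UE.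
  - by apply/forallP=> k; have /forallP/(_ a) := nestU k; rewrite !UaE.
  - apply/forallP=> k; have /forallP/(_ a) := dimU k.
    by rewrite UaE -d_ge0 eqz_nat.
  - apply/forallP=> k; apply/incoming_map_subP => j alpha.
    have /is_subrepP/(_ j a alpha) := subU k.
    by rewrite UaE UE // (no_loop alpha).
move=> [/flag_awayP[subB dimB nestB topB] /and3P[/forallP nestF /forallP dimF /forallP PF]].
split.
- apply/forallP=> k; apply/is_subrepP => i j alpha.
  have [ia|ia] := eqVneq i a.
    by case: (@no_arrow j); rewrite -ia.
  have [ja|ja] := eqVneq j a; last by rewrite !UE // subB.
  rewrite UE //; move: alpha; rewrite ja UaE => alpha.
  by have /incoming_map_subP := PF k; apply.
- apply/forallP => k; apply/forallP => i; have [->|ia] := eqVneq i a.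
    by rewrite UaE (eqP (dimF k)) d_ge0.
  by rewrite UE // dimB.
- apply/forallP => k; apply/forallP => i; have [->|ia] := eqVneq i a.
    by rewrite !UaE.
  by rewrite !UE // nestB.
apply/forallP => i; have [->|ia] := eqVneq i a; last by rewrite UE // topB.
(* [flags_above] does not ask the top term to be the whole space. This follows from its dimension,
   [d ord_max] being the dimension vector of [M]. *)
rewrite UaE eqEdim subvf (eqP (dimF _)) /= -lez_nat d_ge0.
by have /andP[_ /eqP->] := dM; rewrite ffunE.
Qed.


(** Away from [a] the two representations have the same spaces. At [a] the zero space is a
    placeholder: [put_at] overwrites it, and it is the constant by which base points are normalised
    when counting. *)
Definition to_reflected_case i (b : bool) :
    {vspace M i} -> {vspace reflected_space_case M i b} :=
  match b with true => fun=> 0%VS | false => id end.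

Definition of_reflected_case i (b : bool) :
    {vspace reflected_space_case M i b} -> {vspace M i} :=
  match b with true => fun=> 0%VS | false => id end.

Definition reflected_flag B : flag_type nu (reflected_rep a M) :=
  [ffun k => [ffun i : reflected_quiver a =>
     to_reflected_case (i == a) (B k i) : {vspace reflected_rep a M i}]].

Definition unreflected_flag (B : flag_type nu (reflected_rep a M)) : flag_type nu M :=
  [ffun k => [ffun i : Q => of_reflected_case (B k i)]].

(** The tests [i == a] and [j == a] are generalised to booleans, so that a case analysis computes
    the types that depend on them. *)
Lemma reflected_map_case_away i j bi bj (X : {vspace M i}) (Y : {vspace M j}) :
  ~~ bi -> ~~ bj ->
  ((forall alpha, (@reflected_map_case K Q M i j bi bj alpha @:
      to_reflected_case bi X <= to_reflected_case bj Y)%VS) <->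
   (forall alpha : arrow i j, (map_of M alpha @: X <= Y)%VS)).
Proof. by case: bi; case: bj. Qed.

Lemma reflected_map_case_at i j (bi bj : bool) (X : {vspace reflected_space_case M i bi})
    (Y : {vspace M j}) : bi -> ~~ bj ->
  ((forall alpha, (@reflected_map_case K Q M i j bi bj alpha @: X
      <= to_reflected_case bj Y)%VS) <->
   (forall (alpha : arrow j i) x, x \in X ->
      incl_case M i bi x (Tagged (fun j => arrow j i) alpha) \in Y)).
Proof.
case: bi X; case: bj => //= X _ _; split=> [XY alpha x xX|XY alpha].
  rewrite lfunE /= -incoming_ker_projE; apply: (subvP (XY alpha)).
  exact: memv_img.
apply/subvP=> _ /memv_imgP[x xX ->]; rewrite incoming_ker_projE.
by have := XY alpha x xX; rewrite lfunE.
Qed.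

Lemma to_reflected_case_at i (b : bool) (X : {vspace M i}) :
  b -> to_reflected_case b X = 0%VS.
Proof. by case: b. Qed.

Lemma dim_to_reflected_case i b (X : {vspace M i}) : ~~ b ->
  \dim (to_reflected_case b X) = \dim X.
Proof. by case: b. Qed.

Lemma to_reflected_case_sub i b (X Y : {vspace M i}) : ~~ b ->
  (to_reflected_case b X <= to_reflected_case b Y)%VS = (X <= Y)%VS.
Proof. by case: b. Qed.

Lemma to_reflected_case_full i b (X : {vspace M i}) : ~~ b ->
  (to_reflected_case b X == fullv) = (X == fullv).
Proof. by case: b. Qed.

Lemma dim_reflected_case_full i (b : bool) : ~~ b ->
  \dim {: reflected_space_case M i b} = \dim {: M i}.
Proof. by case: b. Qed.

Lemma ffun_mulrz (I : finType) (f : {ffun I -> int}) (z : int) i :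
  (f *~ z) i = f i *~ z.
Proof.
by case: z => n; rewrite ?NegzE ?mulrNz -pmulrn ?ffunE ffunMnE pmulrn.
Qed.

Local Notation d' := (reflected_filtration a M d).

Lemma reflected_filtration_away k i :
  is_filtration_of M d -> i != a -> d' k i = d k i.
Proof.
move=> /andP[/andP[/eqP d0 _] /eqP dM] ia; rewrite /reflected_filtration.
case: eqP => [->|_]; first by rewrite d0 !ffunE.
case: eqP => [->|_]; last first.
  by rewrite !(ffunE, ffun_mulrz) (negPf ia) !mul0rz oppr0 !addr0.
by rewrite dM !ffunE dim_reflected_case_full.
Qed.

(* Unlike eqVneq, this does not abstract the occurrences of i == a in types. *)
Lemma eq_or_neq (i : Q) : i = a \/ i != a.
Proof. by case: eqVneq; [left | right]. Qed.

(** In the reflected quiver [a] is a source, and a reversed arrow acts on the kernel as the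
    projection to its component. Stability at [a] says that all components of a vector of [N^k],
    here [F k], lie in the [B k j], that is, N^k <= V^k. Whether the reflected sequence is a
    filtration still depends on the case, so this condition stays on the right. *)
Lemma Fl_reflected_put_at B (F : {ffun 'I_nu.+1 -> {vspace reflected_rep a M a}}) :
  is_filtration_of M d ->
  Fl (reflected_rep a M) d'
     (put_at (reflected_flag B :
        {ffun 'I_nu.+1 -> {dffun forall i, {vspace reflected_rep a M i}}}) F) =
  [&& flag_away B, is_filtration_of (reflected_rep a M) d' &
      flags_below (sink_kernel B) (fun k => `|d' k a|%N) F].
Proof.
move=> dM; rewrite /Fl /= [RHS]andbCA; case dM': is_filtration_of => //=.
set U := put_at _ _.
have UaE k : U k a = F k by apply: put_at_in.
have UE k (i : Q) : i != a -> U k i = to_reflected_case (i == a) (B k i).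
  by move=> ia; rewrite /U put_at_out // !ffunE.
have d_ge0 k : `|d' k a|%N%:Z = d' k a.
  by rewrite gez0_abs // (is_filtration_ge0 (Q := reflected_quiver a)) //; case/andP: dM'.
apply/and4P/andP => [[/forallP subU /forallP dimU /forallP nestU /forallP topU]|].
  split; [apply/flag_awayP; split | apply/and3P; split].
  - move=> k i j alpha ia ja; have /is_subrepP/(_ i j) := subU k; rewrite !UE //.
    by move/reflected_map_case_away; apply.
  - move=> k i ia; have /forallP/(_ i)/eqP := dimU k.
    by rewrite UE // dim_to_reflected_case // reflected_filtration_away.
  - move=> k i ia; have /forallP/(_ i) := nestU k.
    by rewrite !UE // to_reflected_case_sub.
  - by move=> i ia; have := topU i; rewrite UE // to_reflected_case_full // => /eqP.
  - by apply/forallP=> k; have /forallP/(_ a) := nestU k; rewrite !UaE.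
  - apply/forallP=> k; have /forallP/(_ a) := dimU k.
    by rewrite UaE -d_ge0 eqz_nat.
  - apply/forallP=> k; apply/subvP => x xF; rewrite -memv_preim.
    rewrite mem_dsum_sub; apply/forallP=> -[j alpha] /=.
    have /is_subrepP/(_ a j) := subU k.
    rewrite UaE UE ?(no_loop alpha) //.
    move=> subF; apply: (proj1 (@reflected_map_case_at a j (a == a) (j == a) (F k)
      (B k j) (eqxx a) (no_loop alpha)) subF).
    exact: xF.
move=> [/flag_awayP[subB dimB nestB topB] /and3P[/forallP nestF /forallP dimF /forallP PF]].
split.
- apply/forallP=> k; apply/is_subrepP => i j alpha.
  have [ja|ja] := eqVneq j a.
    case: (@no_arrow i); move: alpha.
    by rewrite /arrow /= /reflected_arrow ja eqxx orbT.
  move: alpha.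
  have [ia|ia] := eqVneq i a; last first.
    rewrite !UE //; apply/reflected_map_case_away; rewrite ?ia ?ja // => alpha.
    exact: subB.
  rewrite (UE k j ja) ia UaE; apply/reflected_map_case_at => // alpha x xF.
  have /subvP/(_ x xF) := PF k; rewrite -memv_preim mem_dsum_sub.
  by move/forallP/(_ (Tagged (fun j => arrow j a) alpha)).
- apply/forallP => k; apply/forallP => i; have [->|ia] := eq_or_neq i.
    by rewrite UaE (eqP (dimF k)) d_ge0.
  by rewrite UE // dim_to_reflected_case // dimB // reflected_filtration_away.
- apply/forallP => k; apply/forallP => i; have [->|ia] := eq_or_neq i.
    by rewrite !UaE.
  by rewrite !UE // to_reflected_case_sub // nestB.
apply/forallP => i; have [->|ia] := eq_or_neq i.
  rewrite UaE eqEdim subvf (eqP (dimF _)) /= -lez_nat d_ge0.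
  by have /andP[_ /eqP->] := dM'; rewrite ffunE.
by rewrite UE // to_reflected_case_full // topB.
Qed.

(** * The reflected dimensions at [a] as a running maximum *)

Lemma sigma_at (e : dimvec Q) : sigma a e a = \sum_(s : arrows_to a) e (tag s) - e a.
Proof.
have sum_unit (f : Q -> int) : \sum_i f i * (i == a)%:R = f a.
  rewrite (bigD1 a) //= eqxx mulr1 big1 ?addr0 // => i /negPf->.
  by rewrite mulr0.
(* No arrow leaves [a], so the form of [e] with the unit vector receives the arrow terms on one side
   only: it is twice [e a] minus the sum of the [e j] over the arrows j -> a. *)
have eulerl : euler_form e (unit_vec a) = e a - \sum_(s : arrows_to a) e (tag s).
  rewrite /euler_form; under eq_bigr do rewrite ffunE; rewrite sum_unit; congr (_ - _).
  rewrite -(sig_big_dep xpredT (fun=> xpredT) (fun j (_ : arrow j a) => e j)) /=.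
  apply: eq_bigr => i _; rewrite (bigD1 a) //= [X in _ + X]big1 ?addr0.
    by apply: eq_bigr => alpha _; rewrite ffunE eqxx mulr1.
  by move=> j ja; apply: big1 => alpha _; rewrite ffunE (negPf ja) mulr0.
have eulerr : euler_form (unit_vec a) e = e a.
  rewrite /euler_form [X in _ - X]big1 ?subr0 => [|i _].
    by under eq_bigr do rewrite ffunE mulrC; apply: sum_unit.
  apply: big1 => j _; apply: big1 => alpha _; rewrite ffunE.
  have [ia|] := eqVneq i a; last by rewrite mul0r.
  by case: (@no_arrow j); rewrite -ia.
rewrite /sigma !(ffunE, ffun_mulrz) eqxx /sym_euler_form eulerl eulerr.
by rewrite intz; move: (\sum_s _) (e a) => x y; lia.
Qed.

Lemma sigma_at0 : sigma a (0 : dimvec Q) a = 0.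
Proof. by rewrite sigma_at ffunE big1 // => s _; rewrite ffunE. Qed.

Lemma sigma_atB (e f : dimvec Q) : sigma a (e - f) a = sigma a e a - sigma a f a.
Proof.
rewrite !sigma_at; under eq_bigr do rewrite !ffunE.
rewrite !ffunE sumrB.
by move: (\sum_s e _) (\sum_s f _) (e a) (f a) => x y z t; lia.
Qed.

(* Off the last term this is the a-component of S_a^+ d; it turns out to be the
   running maximum of the integers (sigma_a d^j)_a. *)
Definition reflected_dim (i : nat) : int := sigma a (d (inord i)) a + r_plus a d i.

(** With s_i the a-component of the reflected d^i and r_i = [r_plus a d i], additivity of [sigma]
    gives s_(i+1) + max(0, s_i - s_(i+1) + r_i) = max(s_(i+1), s_i + r_i). *)
Lemma reflected_dimS i :
  reflected_dim i.+1 = Num.max (sigma a (d (inord i.+1)) a) (reflected_dim i).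
Proof. by rewrite /reflected_dim /= sigma_atB; lia. Qed.

Lemma reflected_dim_ge i : sigma a (d (inord i)) a <= reflected_dim i.
Proof.
by case: i => [|i]; [rewrite /reflected_dim /= addr0 | rewrite reflected_dimS le_max lexx].
Qed.

Lemma reflected_dim_le i (m : int) :
  (forall j, (j <= i)%N -> sigma a (d (inord j)) a <= m) -> reflected_dim i <= m.
Proof.
elim: i => [|i IHi] le_m; first by rewrite /reflected_dim /= addr0 le_m.
by rewrite reflected_dimS ge_max le_m // IHi // => j ji; rewrite le_m // leqW.
Qed.

(** * One numerical criterion for both fibres over a fixed flag away from [a] *)

Section FixedBase.
Variable B : flag_type nu M.
Hypotheses (dM : is_filtration_of M d) (B_away : flag_away B).

Let filt : is_filtration d. Proof. by case/andP: dM. Qed.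
Let d_top : d ord_max = dim_vec M. Proof. by case/andP: dM => _ /eqP. Qed.

(** Both sides are dim V^k: the left by rank-nullity, the right because the dimensions d^k_j over
    the arrows j -> a add up to it. *)
Lemma dim_kernel_image k :
  (\dim (sink_kernel B k))%:Z + (\dim (sink_image B k))%:Z = sigma a (d k) a + d k a.
Proof.
have /flag_awayP[_ dimB _ _] := B_away.
rewrite -PoszD dim_incl_preim // dim_incoming_sub sigma_at subrK.
rewrite -[LHS]natz natr_sum; apply: eq_bigr => -[j alpha] _ /=.
by rewrite natz dimB // (no_loop alpha).
Qed.

Lemma incoming_sub_mono k l :
  (k <= l)%N -> (incoming_sub a (B k) <= incoming_sub a (B l))%VS.
Proof.
have /flag_awayP[_ _ nestB _] := B_away.
move=> kl; apply: dsum_sub_mono => -[j alpha] /=.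
apply: (monotone_ordP (fun k => B k j) (@subvv _ _) (@subv_trans _ _)) kl.
by apply/forallP=> i; apply: nestB; apply: no_loop alpha.
Qed.

Lemma sink_kernel_mono k l : (k <= l)%N -> (sink_kernel B k <= sink_kernel B l)%VS.
Proof. by move=> kl; apply/lpreimS/incoming_sub_mono. Qed.

Lemma sink_image_mono k l : (k <= l)%N -> (sink_image B k <= sink_image B l)%VS.
Proof. by move=> kl; apply/limgS/incoming_sub_mono. Qed.

Lemma sink_kernel_top : sink_kernel B ord_max = fullv.
Proof.
have /flag_awayP[_ _ _ topB] := B_away.
apply/eqP; rewrite eqEsubv subvf; apply/subvP=> x _; rewrite -memv_preim mem_dsum_sub.
by apply/forallP=> -[j alpha] /=; rewrite topB ?memvf // (no_loop alpha).
Qed.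

Lemma dim_mono (k l : 'I_nu.+1) : (k <= l)%N -> (`|d k a| <= `|d l a|)%N.
Proof.
move=> kl; rewrite -lez_nat !gez0_abs ?is_filtration_ge0 //.
apply: (monotone_ordP (fun k => d k a) lexx le_trans) kl.
by apply/forallP=> i; have /andP[_ /forallP/(_ i)/forallP] := filt.
Qed.

Definition fibre_nonempty := [forall k, (\dim (sink_image B k) <= `|d k a|)%N].

Lemma flags_above_nonempty F :
  flags_above (sink_image B) (fun k => `|d k a|%N) F -> fibre_nonempty.
Proof.
move=> /and3P[_ /forallP dimF /forallP PF]; apply/forallP=> k.
by rewrite -(eqP (dimF k)) dimvS.
Qed.

Lemma dim_bounds k :
  fibre_nonempty -> (\dim (sink_image B k) <= `|d k a| <= \dim {: M a})%N.
Proof.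
move=> /forallP-> /=.
have -> : \dim {: M a} = `|d ord_max a|%N by rewrite d_top ffunE.
by rewrite dim_mono // -ltnS.
Qed.

Lemma reflected_filtration_top : d' ord_max a = (\dim {: reflected_rep a M a})%:Z.
Proof.
(* For nu = 0 the top term is also the initial one, where the reflected filtration is set to 0. Then
   [d] vanishes, and [dim_kernel_image] shows that the kernel vanishes too. *)
rewrite /reflected_filtration eqxx; case: eqP => [max0|_]; last by rewrite ffunE.
have := dim_kernel_image ord_max; rewrite sink_kernel_top max0.
have -> : d ord0 = 0 by case/andP: filt => /eqP.
by rewrite sigma_at0 ffunE; lia.
Qed.

Lemma reflected_filtration_at k : k != ord_max -> d' k a = reflected_dim k.
Proof.
rewrite /reflected_filtration => /negPf->; case: eqP => [->|_].
  rewrite /reflected_dim /= addr0.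
  have -> : inord 0 = ord0 :> 'I_nu.+1 by apply: val_inj; rewrite /= inordK.
  have -> : d ord0 = 0 by case/andP: filt => /eqP.
  by rewrite sigma_at0 ffunE.
by rewrite ffunE ffun_mulrz [X in _ + X *~ _]ffunE eqxx intz /reflected_dim inord_val.
Qed.

(** For k < nu the space N^k has dimension at least dim V^k - d^k_a and lies in the kernel of phi on
    V^k, which leaves at most d^k_a for dim phi(V^k). At the top, phi(V^k) lies in M_a. *)
Lemma flags_below_nonempty F : is_filtration_of (reflected_rep a M) d' ->
  flags_below (sink_kernel B) (fun k => `|d' k a|%N) F -> fibre_nonempty.
Proof.
move=> /andP[filt' _] /and3P[_ /forallP dimF /forallP FA]; apply/forallP=> k.
have [->|k_max] := eqVneq k ord_max.
  by rewrite d_top ffunE dimvS ?subvf.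
have := dim_kernel_image k; have := reflected_dim_ge k; rewrite inord_val.
rewrite -reflected_filtration_at // -[d' k a]gez0_abs; last first.
  exact: (is_filtration_ge0 (Q := reflected_quiver a)).
rewrite -(eqP (dimF k)); have := dimvS (FA k).
by have := is_filtration_ge0 k a filt; lia.
Qed.

(** Below the top each entry of the running maximum is dim V^j - d^j_a for some j <= k. The
    criterion bounds it by the dimension of the intersection of N with V^j, which grows with j. *)
Lemma reflected_filtration_le k :
  fibre_nonempty -> d' k a <= (\dim (sink_kernel B k))%:Z.
Proof.
move=> /forallP ne; have [->|k_max] := eqVneq k ord_max.
  by rewrite sink_kernel_top reflected_filtration_top.
rewrite reflected_filtration_at //; apply: reflected_dim_le => j jk.
have j_lt : (j < nu.+1)%N := leq_ltn_trans jk (ltn_ord k).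
have := dimvS (@sink_kernel_mono (inord j) k _); rewrite inordK // => /(_ jk).
have := dim_kernel_image (inord j); have := ne (inord j).
by have := is_filtration_ge0 (inord j) a filt; lia.
Qed.

Lemma is_filtration_of_reflected :
  fibre_nonempty -> is_filtration_of (reflected_rep a M) d'.
Proof.
move=> ne; apply/andP; split.
  apply/andP; split; first by rewrite /reflected_filtration eqxx.
  apply/forallP=> k; apply/forallP=> i; have [->|ia] := eq_or_neq i; last first.
    rewrite !reflected_filtration_away //.
    by have /andP[_ /forallP/(_ k)/forallP] := filt.
  (* The last step is treated apart, since the top term is dim N and not a running maximum. The term
     before it is the dimension of a subspace of N at most. *)
  have [->|k_max] := eqVneq (lift ord0 k) ord_max.
    rewrite reflected_filtration_top.
    by apply: le_trans (reflected_filtration_le _ ne) _; rewrite lez_nat dimvS ?subvf.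
  rewrite !reflected_filtration_at //.
    by rewrite lift0 reflected_dimS le_max lexx orbT.
  by rewrite -val_eqE /= neq_ltn ltn_ord.
apply/eqP/ffunP=> i; have [->|ia] := eq_or_neq i.
  by rewrite reflected_filtration_top ffunE.
rewrite reflected_filtration_away // d_top !ffunE.
by rewrite dim_reflected_case_full.
Qed.

Lemma reflected_dim_mono (k l : 'I_nu.+1) :
  fibre_nonempty -> (k <= l)%N -> (`|d' k a| <= `|d' l a|)%N.
Proof.
move=> /is_filtration_of_reflected/andP[filt' _] kl.
rewrite -lez_nat !gez0_abs ?(is_filtration_ge0 (Q := reflected_quiver a)) //.
apply: (monotone_ordP (fun k => d' k a) lexx le_trans) kl.
by apply/forallP=> i; have /andP[_ /forallP/(_ i)/forallP] := filt'.
Qed.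

Lemma reflected_dim_bound k :
  fibre_nonempty -> (`|d' k a| <= \dim (sink_kernel B k))%N.
Proof.
move=> ne; have /andP[filt' _] := is_filtration_of_reflected ne.
rewrite -lez_nat gez0_abs ?reflected_filtration_le //.
exact: (is_filtration_ge0 (Q := reflected_quiver a)).
Qed.

End FixedBase.

End Fibres.

(** * Comparison of the two flag varieties, fibre by fibre *)

Section Comparison.
Variables (Q : quiver) (a : Q) (nu : nat) (d : 'I_nu.+1 -> dimvec Q).
Hypothesis a_sink : is_sink a.

(** The round trip forgets exactly the component at [a], so it fixes the base points normalised to
    zero there. *)
Lemma reflected_flagK (K : fieldType) (M : representation K Q) (B : flag_type nu M) :
  (unreflected_flag (reflected_flag a B) == B) = [forall k, B k a == 0%VS].
Proof.
apply/eqP/forallP => [<- k|B0].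
  rewrite !ffunE; apply/eqP.
  by move: (a == a) (eqxx a) (B k a) => -[].
apply/ffunP=> k; apply/ffunP=> i; rewrite !ffunE.
have [->|ia] := eq_or_neq a i.
  by rewrite (eqP (B0 k)); move: (a == a) => -[].
by move: (i == a) ia (B k i) => -[].
Qed.

Lemma reflected_flag_put (K : fieldType) (M : representation K Q)
    (U : flag_type nu (reflected_rep a M)) :
  U = put_at (reflected_flag a (unreflected_flag U) :
        {ffun 'I_nu.+1 -> {dffun forall i, {vspace reflected_rep a M i}}})
      [ffun k => U k a].
Proof.
apply: put_atP => [k i ia|k]; rewrite !ffunE //.
by move: (U k i); rewrite /=; move: (i == a) ia => -[].
Qed.

(** A flag on either side yields the criterion [fibre_nonempty] for its part away from [a], and the
    criterion provides a point in the other fibre over the same part. No counting occurs, so the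
    field is arbitrary. *)
Lemma Fl_inhabited_iff (K : fieldType) (M : representation K Q) :
  is_filtration_of M d ->
  (exists U, Fl M d U) <->
  (exists U, Fl (reflected_rep a M) (reflected_filtration a M d) U).
Proof.
move=> dM; split=> -[U].
  have -> : U = put_at (U : {ffun 'I_nu.+1 -> {dffun forall i, {vspace M i}}})
      [ffun k => U k a] by apply: put_atP => // k; rewrite ffunE.
  rewrite Fl_put_at // => /andP[U_away /flags_above_nonempty ne].
  have [|||F FP] := @exists_flags_below _ _ nu (sink_kernel a U)
    (fun k => `|reflected_filtration a M d k a|%N).
  - exact: (sink_kernel_mono a_sink U_away).
  - by move=> k l; apply: (reflected_dim_mono a_sink dM U_away).
  - by move=> k; apply: (reflected_dim_bound a_sink dM U_away).
  exists (put_at (reflected_flag a U :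
    {ffun 'I_nu.+1 -> {dffun forall i, {vspace reflected_rep a M i}}}) F).
  by rewrite Fl_reflected_put_at // U_away FP (is_filtration_of_reflected a_sink dM U_away).
rewrite (reflected_flag_put U) Fl_reflected_put_at //; set B := unreflected_flag U.
move=> /and3P[B_away dM' /(flags_below_nonempty a_sink dM B_away dM') ne].
have [|||F FP] := @exists_flags_above _ _ nu (sink_image a B) (fun k => `|d k a|%N).
- exact: (sink_image_mono a_sink B_away).
- by move=> k l; apply: (dim_mono a dM).
- by move=> k; apply: (dim_bounds dM).
exists (put_at (B : {ffun 'I_nu.+1 -> {dffun forall i, {vspace M i}}}) F).
by rewrite Fl_put_at // B_away FP.
Qed.

(** The boolean on the right is read as 0 or 1. [card_reflected_fibre] has the same right-hand side,
    which makes the two fibres congruent. *)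
Lemma card_fibre (K : finFieldType) (M : representation K Q) (B : flag_type nu M) :
  is_filtration_of M d ->
  #|[pred F : {ffun 'I_nu.+1 -> {vspace M a}} | Fl M d
      (put_at (B : {ffun 'I_nu.+1 -> {dffun forall i, {vspace M i}}}) F)]|
    = flag_away a d B && fibre_nonempty a d B %[mod #|K|].
Proof.
move=> dM; under eq_card => F do rewrite inE Fl_put_at //.
have [B_away|_] := boolP (flag_away a d B); last by rewrite eq_card0.
have [ne|/negP ne] := boolP (fibre_nonempty a d B); last first.
  by rewrite eq_card0 // => F; apply/negP => /flags_above_nonempty.
rewrite -(@card_flags_above _ _ nu (sink_image a B) (fun k => `|d k a|%N)) //.
- exact: (sink_image_mono a_sink B_away).
- by move=> k l; apply: (dim_mono a dM).
- by move=> k; apply: (dim_bounds dM).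
Qed.

Lemma card_reflected_fibre (K : finFieldType) (M : representation K Q)
    (B : flag_type nu M) :
  is_filtration_of M d ->
  #|[pred F : {ffun 'I_nu.+1 -> {vspace reflected_rep a M a}} | Fl (reflected_rep a M) (reflected_filtration a M d)
      (put_at (reflected_flag a B :
        {ffun 'I_nu.+1 -> {dffun forall i, {vspace reflected_rep a M i}}}) F)]|
    = flag_away a d B && fibre_nonempty a d B %[mod #|K|].
Proof.
move=> dM; under eq_card => F do rewrite inE Fl_reflected_put_at //.
have [B_away|_] := boolP (flag_away a d B); last by rewrite eq_card0.
have [ne|/negP ne] := boolP (fibre_nonempty a d B); last first.
  rewrite eq_card0 // => F; apply/negP => /andP[dM'].
  by move/(flags_below_nonempty a_sink dM B_away dM').
rewrite (is_filtration_of_reflected a_sink dM B_away ne).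
rewrite -(@card_flags_below _ _ nu (sink_kernel a B)
  (fun k => `|reflected_filtration a M d k a|%N)) //.
- exact: (sink_kernel_mono a_sink B_away).
- by move=> k l; apply: (reflected_dim_mono a_sink dM B_away).
- by move=> k; apply: (reflected_dim_bound a_sink dM B_away).
Qed.

Lemma card_Fl_mod (K : finFieldType) (M : representation K Q) :
  is_filtration_of M d ->
  #|Fl M d| = #|Fl (reflected_rep a M) (reflected_filtration a M d)| %[mod #|K|].
Proof.
move=> dM.
rewrite (@card_put_at Q a nu.+1 (fun i => {vspace M i} : finType) 0%VS (Fl M d)).
rewrite (@card_put_at Q a nu.+1 (fun i => {vspace reflected_rep a M i} : finType) 0%VS
  (Fl (reflected_rep a M) (reflected_filtration a M d))).
(* The base points of the reflected side are parametrised by those of [M], so that both sums run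
   over the same [B]. *)
rewrite [in RHS](reindex_onto (fun B : flag_type nu M => reflected_flag a B)
   (fun U => unreflected_flag U)) /=; last first.
  move=> U /forallP U0; rewrite [RHS]reflected_flag_put; apply: put_atP => // k.
  rewrite !ffunE (eqP (U0 k)).
  by move: (a == a) => -[].
under [in RHS]eq_bigl => B.
  rewrite (reflected_flagK B).
  have -> : [forall k, reflected_flag a B k a == 0%VS].
    by apply/forallP=> k; rewrite !ffunE; apply/eqP/to_reflected_case_at/eqxx.
  over.
apply: eq_sum_mod => B _.
by rewrite card_fibre // card_reflected_fibre.
Qed.

End Comparison.

Theorem theorem6p20 (Q : quiver) (a : Q) (nu : nat) (d : 'I_nu.+1 -> dimvec Q)
    (a_sink : is_sink a) (d_filtration : is_filtration d) :
  (forall (K : fieldType) (M : representation K Q),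
     dim_vec M = d ord_max ->
     (Fl M d =i pred0 <->
      Fl (reflected_rep a M) (reflected_filtration a M d) =i pred0)) /\
  (forall (K : finFieldType) (M : representation K Q),
     dim_vec M = d ord_max ->
     #|Fl M d| =
     #|Fl (reflected_rep a M) (reflected_filtration a M d)| %[mod #|K|]).
Proof.
split=> K M dM.
  have /(Fl_inhabited_iff a_sink)[Fl1 Fl2] : is_filtration_of M d.
    by rewrite /is_filtration_of d_filtration dM eqxx.
  split=> Fl0 U; apply/negbTE/negP => FlU.
    by have [V FlV] := Fl2 (ex_intro _ U FlU); have := Fl0 V; rewrite -topredE /= FlV.
  by have [V FlV] := Fl1 (ex_intro _ U FlU); have := Fl0 V; rewrite -topredE /= FlV.
apply: card_Fl_mod => //.
by rewrite /is_filtration_of d_filtration dM eqxx.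
Qed.
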